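(* Consider the finite-horizon remote estimation problem for a first-order autoregressive source over an i.i.d. packet-drop channel (a channel with a single state), with value functions $J_t$ as in the context. Then, for every $t\in\{0,\dots,T\}$, the value function $J_t(e)$ and the optimal transmission strategy $f_t(e)$ are even and quasi-convex in $e$ (for the strategy: there is an arg min selection with this property).
   Context: $\mathbb X$ is $\mathbb Z$ or $\mathbb R$; $a\in\mathbb X$; $W$ is an $\mathbb X$-valued random variable with symmetric (about $0$) unimodal distribution (pdf if $\mathbb X=\mathbb R$, pmf if $\mathbb X=\mathbb Z$). $\mathbb U\subset\mathbb R_{\ge0}$ is either a finite set $\{0,u_{(1)},\dots,u_{\max}\}$ or $[0,u_{\max}]$. The packet-drop probability $p(u)\in[0,1]$ is weakly decreasing in $u$ with $p(0)=1$. The transmission cost $\lambda$ is weakly increasing on $\mathbb U$ with $\lambda(0)=0$, $\lambda(u_{\max})<\infty$; the distortion $d:\mathbb X\to\mathbb R$ is even and quasi-convex with $d(0)=0$. Value functions: $J_{T+1}\equiv0$ and, for $t=T,\dots,0$, $$J_t(e)=\min_{u\in\mathbb U}\Big\{\lambda(u)+p(u)d(e)+p(u)\,\mathbb E[J_{t+1}(ae+W)]+(1-p(u))\,\mathbb E[J_{t+1}(W)]\Big\},$$ and $f_t(e)$ denotes an arg min. Here $e$ is the error between the source and the receiver's prediction at time $t$. The minima are understood to be attained. *)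

(* Defs.v *)
From HB Require Import structures.
From mathcomp Require Import all_boot all_order all_algebra.
From mathcomp Require Import all_classical all_reals all_analysis.
Set Implicit Arguments.
Unset Strict Implicit.
Unset Printing Implicit Defensive.
Import Order.TTheory GRing.Theory Num.Theory.
Import numFieldNormedType.Exports.
Local Open Scope classical_set_scope.
Local Open Scope ring_scope.

(* [unimodal] allows an arbitrary mode m. Quasi-convexity is expressed through
   betweenness, which makes sense both on the integers and on the reals; on the
   reals x <= y <= z says that y is a convex combination of x and z. *)
Section Shape.
Context {X : realDomainType} {disp : Order.disp_t} {Y : orderType disp}.
Implicit Type f : X -> Y.

Definition even_function f : Prop := forall x, f (- x) = f x.

Definition quasi_convex f : Prop :=
  forall x y z, x <= y <= z -> (f y <= Order.max (f x) (f z))%O.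

Definition unimodal f : Prop :=
  exists m, (forall x y, x <= y <= m -> (f x <= f y)%O) /\
            (forall x y, m <= x <= y -> (f y <= f x)%O).

End Shape.

Inductive source_kind := IntegerSource | RealSource.

Definition alphabet (R : realType) (k : source_kind) : realDomainType :=
  match k with IntegerSource => int | RealSource => R end.

(* W is a random variable with symmetric unimodal pmf (integer alphabet), resp.
   with a symmetric unimodal pdf with respect to Lebesgue measure (real
   alphabet). For the integers, measurability refers to the discrete
   sigma-algebra, which is generated by the singletons. *)
Definition symmetric_unimodal_noise (R : realType) (disp : measure_display)
    (Omega : measurableType disp) (P : probability Omega R) (k : source_kind) :
    (Omega -> alphabet R k) -> Prop :=
  match k return (Omega -> alphabet R k) -> Prop with
  | IntegerSource => fun W : Omega -> int =>
      let pmf := fun n : int => P (W @^-1` [set n]) in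
      [/\ (forall n : int, measurable (W @^-1` [set n])),
          even_function pmf & unimodal pmf]
  | RealSource => fun W : Omega -> R =>
      measurable_fun [set: Omega] W /\
      exists pdf : R -> R,
        [/\ measurable_fun [set: R] pdf,
            (forall x, 0 <= pdf x),
            (forall A : set R, measurable A ->
               P (W @^-1` A) = \int[lebesgue_measure]_(x in A) (pdf x)%:E)%E,
            even_function pdf & unimodal pdf]
  end.

Definition action_set (R : realType) (U : set R) (umax : R) : Prop :=
  [/\ finite_set U, U 0, U umax & U `<=` [set` `[0, umax]]] \/
  U = [set` `[0, umax]].

Definition is_argmin (R : realType) (U : set R) (F : R -> \bar R) (u : R) :
    Prop :=
  U u /\ lbound [set F v | v in U] (F u).

(* The bracket minimised over u at error e, with Jnext the value function at
   the next time. Expectations of value functions may be infinite, hence the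
   extended reals; there 0 * +oo = 0. *)
Definition stage_cost (R : realType) (disp : measure_display)
    (Omega : measurableType disp) (P : probability Omega R)
    (X : realDomainType) (a : X) (W : Omega -> X) (lam p : R -> R) (d : X -> R)
    (Jnext : X -> \bar R) (e : X) (u : R) : \bar R :=
  ((lam u)%:E + (p u)%:E * (d e)%:E
   + (p u)%:E * \int[P]_w Jnext (a * e + W w)%R
   + (1 - p u)%:E * \int[P]_w Jnext (W w))%E.

(* The last clause says that J t e is the minimum of the bracket over U, and
   in particular that this minimum is attained. *)
Definition value_functions (R : realType) (disp : measure_display)
    (Omega : measurableType disp) (P : probability Omega R)
    (X : realDomainType) (a : X) (W : Omega -> X) (lam p : R -> R) (d : X -> R)
    (U : set R) (T : nat) (J : nat -> X -> \bar R) : Prop :=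
  (forall e, J T.+1 e = 0%E) /\
  (forall t e, (t <= T)%N ->
     exists2 u, is_argmin U (stage_cost P a W lam p d (J t.+1) e) u &
                J t e = stage_cost P a W lam p d (J t.+1) e u).

(* Main.v *)
(* "Even and quasi-convex" means nondecreasing in |x|. This is preserved by
   x |-> E[J(x + W)]: reflecting the integration variable about -(y - x)/2
   exchanges x - w with y + w and the density at w with that at (y - x) + w, and
   the larger value of J always meets the smaller displacement on the y side, so
   the claim is a two-point rearrangement inequality. The Bellman bracket then
   reads lam u + p u * g(e) + (1 - p u) * K with g nondecreasing in |e| and
   g >= K = E[J(W)]. Raising g makes small p more attractive, so minimisers move
   to smaller p and larger lam; choosing one representative action in each class
   of actions with equal (p, lam) makes the selection monotone without any
   continuity of p or lam. *)
Require Import Defs.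
From HB Require Import structures.
From mathcomp Require Import all_boot all_order all_algebra.
From mathcomp Require Import all_classical all_reals all_analysis.
From mathcomp Require Import measurable_realfun ring lra.
Set Implicit Arguments.
Unset Strict Implicit.
Unset Printing Implicit Defensive.
Import Order.TTheory GRing.Theory Num.Theory.
Import numFieldNormedType.Exports.
Local Open Scope classical_set_scope.
Local Open Scope ring_scope.

(** * Shape conditions in terms of the absolute value *)

Definition radially_nondecreasing (X : realDomainType) (disp : Order.disp_t)
    (Y : orderType disp) (f : X -> Y) : Prop :=
  forall x y, `|x| <= `|y| -> (f x <= f y)%O.

(** If [|x| <= |y|] then [x] lies between [- |y|] and [|y|], where an even [f] takes the single
    value [f y]. Conversely, the middle one of three ordered points is dominated in absolute value
    by the right one when it is nonnegative and by the left one otherwise. *)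
Lemma even_quasi_convexP (X : realDomainType) (disp : Order.disp_t)
    (Y : orderType disp) (f : X -> Y) :
  (even_function f /\ quasi_convex f) <-> radially_nondecreasing f.
Proof.
split=> [[fE fQ] x y xy|fR].
  have := fQ (- `|y|) x `|y|; rewrite -ler_norml xy fE maxxx => /(_ isT).
  by case: (ger0P y); rewrite ?fE.
split=> [x|x y z /andP[xy yz]].
  by apply/eqP; rewrite eq_le !fR ?normrN.
rewrite le_max; apply/orP; have [y0|y0] := leP 0 y.
- by right; apply: fR; rewrite !ger0_norm// (le_trans y0).
- left; apply: fR; rewrite !ler0_norm ?lerN2// ?(ltW y0)//.
  by rewrite (le_trans xy)// ltW.
Qed.

(** The mode [m] need not be 0. If [m <= |x|], the decreasing branch covers [|x|] and [|y|];
    otherwise [- |y| <= - |x| <= m], and the increasing branch covers the reflected points. *)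
Lemma even_unimodal_norm (X : realDomainType) (disp : Order.disp_t)
    (Y : orderType disp) (f : X -> Y) : even_function f -> unimodal f ->
  forall x y, `|x| <= `|y| -> (f y <= f x)%O.
Proof.
move=> fE [m [fl fr]] x y xy.
have fN z : f z = f `|z| by case: (ger0P z); rewrite ?fE.
rewrite (fN x) (fN y); have [mx|xm] := leP m `|x|; first by rewrite fr ?mx.
rewrite -fE -[leRHS]fE fl// lerN2 xy/= (le_trans _ (ltW xm))//.
by rewrite (le_trans _ (normr_ge0 x))// oppr_le0.
Qed.

(** * Monotone selection of minimisers *)

Section ArgminSelection.
Context (R : realType) (U : set R) (umax : R) (lam p : R -> R).
Hypotheses (Umax : U umax) (U_le : forall u, U u -> u <= umax).
Hypothesis p_range : forall u, U u -> 0 <= p u <= 1.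
Hypothesis p_decr : forall u v, U u -> U v -> u <= v -> p v <= p u.
Hypothesis lam_incr : forall u v, U u -> U v -> u <= v -> lam u <= lam v.

(** Here [g] is the cost incurred after a drop and [K] the one after a reception, so that the error
    enters through [g] alone. *)
Definition switching_cost (K g : \bar R) (u : R) : \bar R :=
  ((lam u)%:E + (p u)%:E * g + (1 - p u)%:E * K)%E.

Definition indistinguishable (u : R) : set R :=
  [set v | [/\ U v, p v = p u & lam v = lam u]].

Definition representative (u : R) : R := xget 0 (indistinguishable u).

Lemma representativeP u : U u -> indistinguishable u (representative u).
Proof. by move=> Uu; apply: xgetPex; exists u. Qed.

Lemma switching_cost_representative K g u : U u ->
  switching_cost K g (representative u) = switching_cost K g u.
Proof. by move=> /representativeP[_ pE lE]; rewrite /switching_cost pE lE. Qed.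

(** If the representatives were in the opposite strict order, monotonicity of [p] and [lam] would
    turn both hypotheses into equalities. The two classes would then be the same set, and [xget]
    would pick the same point. *)
Lemma le_representative u v : U u -> U v -> p v <= p u -> lam u <= lam v ->
  representative u <= representative v.
Proof.
move=> Uu Uv pvu luv; have [ru pu lu] := representativeP Uu.
have [rv pv lv] := representativeP Uv.
have [//|rvu] := leP.
have pE : p u = p v.
  by apply/le_anti; rewrite pvu andbT -pu -pv p_decr// ltW.
have lE : lam u = lam v.
  by apply/le_anti; rewrite luv/= -lu -lv lam_incr// ltW.
by move: rvu; rewrite /representative /indistinguishable pE lE ltxx.
Qed.

(* When every action costs +oo, the largest one is taken, because any other choice
   could lie below an action selected at a smaller, finite g. *)
Definition best_action (K g : \bar R) : R :=
  if `[< forall u, U u -> switching_cost K g u = +oo%E >] then umax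
  else xget 0 (is_argmin U (switching_cost K g)).

Lemma best_actionP K g u : is_argmin U (switching_cost K g) u ->
  is_argmin U (switching_cost K g) (best_action K g).
Proof.
rewrite /best_action; case: asboolP => [allE _|_ uP]; last first.
  by apply: xgetPex; exists u.
by split=> // _ [v Uv <-]; rewrite !allE.
Qed.

(** For finite costs and minimisers [u] at [g], [v] at [g'], adding the two optimality inequalities
    gives [(p u - p v) * (g' - g) >= 0]. Optimality of [u] against [v] then gives [lam u - lam v <=
    (p v - p u) * (g - K) <= 0]. *)
Lemma best_action_exchange (K g g' : \bar R) : (0 <= K)%E -> (K <= g)%E ->
    (g <= g')%E ->
    is_argmin U (switching_cost K g) (best_action K g) ->
    is_argmin U (switching_cost K g') (best_action K g') ->
  p (best_action K g') <= p (best_action K g) /\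
  lam (best_action K g) <= lam (best_action K g').
Proof.
move=> K0 Kg; rewrite le_eqVlt => /orP[/eqP->//|gg'] [Uu uP] [Uv vP].
have [allE|nallE] :=
    pselect (forall u, U u -> switching_cost K g' u = +oo%E).
  have -> : best_action K g' = umax by rewrite /best_action asboolT.
  by split; [apply: p_decr|apply: lam_incr] => //; apply: U_le.
have {nallE} : (switching_cost K g' (best_action K g') < +oo)%E.
  have [//|] := ltP _ +oo%E; rewrite leye_eq => /eqP vy.
  case: nallE => u0 Uu0; apply/eqP; rewrite -leye_eq -vy.
  by apply: vP; exists u0.
move: (best_action K g) (best_action K g') Uu Uv uP vP => u v Uu Uv uP vP.
have {uP} : (switching_cost K g u <= switching_cost K g v)%E.
  by apply: uP; exists v.
have {vP} : (switching_cost K g' v <= switching_cost K g' u)%E.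
  by apply: vP; exists u.
have /andP[pu0 pu1] := p_range Uu; have /andP[pv0 pv1] := p_range Uv.
(* Since [K <= g < g'], only [g'] can be infinite. *)
have gfin : g \is a fin_num.
  by rewrite ge0_fin_numE ?(lt_le_trans gg') ?leey// (le_trans K0).
have Kfin : K \is a fin_num.
  by rewrite ge0_fin_numE// (le_lt_trans Kg)// ltey_eq gfin.
rewrite /switching_cost; move: K g K0 Kg gg' gfin Kfin => [k| |]// [r| |]//.
move=> k0 kr rr' _ _; move: k0 kr rr'.
case: g' => [r'| |]//; rewrite !lee_fin ?lte_fin => k0 kr rr'.
  rewrite -?EFinM -?EFinD ?lee_fin => vu uv _.
  have pvu : p v <= p u by nra.
  by split=> //; nra.
(* Case [g' = +oo]: the cost of [v] is finite, which forces [p v = 0] by the convention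
   [0 * +oo = 0]. *)
have [->|pv_neq0] := eqVneq (p v) 0.
  rewrite mul0e => _ uv _; move: uv; rewrite ?lee_fin => uv.
  by split=> //; nra.
rewrite mulry gtr0_sg ?mul1e ?lt0r ?pv_neq0//.
Qed.

Lemma monotone_argmin_selection (X : realDomainType) (K : \bar R)
    (g : X -> \bar R) : (0 <= K)%E -> (forall e, (K <= g e)%E) ->
    radially_nondecreasing g ->
    (forall e, exists u, is_argmin U (switching_cost K (g e)) u) ->
  exists f : X -> R,
    (forall e, is_argmin U (switching_cost K (g e)) (f e)) /\
    radially_nondecreasing f.
Proof.
move=> K0 Kg gR gA.
have bP e : is_argmin U (switching_cost K (g e)) (best_action K (g e)).
  by have [u] := gA e; exact: best_actionP.
exists (fun e => representative (best_action K (g e))); split=> [e|x y xy].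
  have [Ub bmin] := bP e; split; first by have [] := representativeP Ub.
  by rewrite switching_cost_representative.
have [py ly] := best_action_exchange K0 (Kg x) (gR _ _ xy) (bP x) (bP y).
by apply: le_representative => //; [have [] := bP x|have [] := bP y].
Qed.

End ArgminSelection.

(** * Two-point rearrangement *)

Section Rearrangement.
Context (R : realType).
Local Open Scope ereal_scope.

(** For finite values this is [(b - a) * (q - p) >= 0]. If [a] or [p] is infinite, or [b] or [q] is
    zero, both sides agree; in the other infinite cases the right side is [+oo]. *)
Lemma ereal_rearrangement (a b p q : \bar R) :
  0 <= a -> a <= b -> 0 <= p -> p <= q -> b * p + a * q <= a * p + b * q.
Proof.
move=> a0 ab p0 pq; have b0 := le_trans a0 ab; have q0 := le_trans p0 pq.
have [aoo|an] := eqVneq a +oo.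
  by have -> : b = +oo by [apply/eqP; rewrite -leye_eq -aoo]; rewrite aoo.
have [poo|pn] := eqVneq p +oo.
  have -> : q = +oo by [apply/eqP; rewrite -leye_eq -poo].
  by rewrite poo addeC.
have [b0E|bn0] := eqVneq b 0.
  have -> : a = 0 by apply/le_anti; rewrite a0 -b0E ab.
  by rewrite b0E !mul0e.
have [q0E|qn0] := eqVneq q 0.
  have -> : p = 0 by apply/le_anti; rewrite p0 -q0E pq.
  by rewrite q0E !mule0.
have bgt0 : 0 < b by rewrite lt0e bn0.
have qgt0 : 0 < q by rewrite lt0e qn0.
have [boo|bn] := eqVneq b +oo.
  by rewrite boo (gt0_mulye qgt0) [leRHS]addeC addye ?leey// gt_eqF//
    (lt_le_trans _ (mule_ge0 a0 p0)).
have [qoo|qn] := eqVneq q +oo.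
  by rewrite qoo (gt0_muley bgt0) [leRHS]addeC addye ?leey// gt_eqF//
    (lt_le_trans _ (mule_ge0 a0 p0)).
move: a b p q a0 ab p0 pq {b0 q0 bn0 qn0 bgt0 qgt0} an pn bn qn.
move=> [a| |]// [b| |]// [p| |]// [q| |]//.
rewrite -!EFinM -!EFinD !lee_fin => a0 ab p0 pq _ _ _ _.
nra.
Qed.

(** After squaring, with [s = y - x], the product of the two differences equals
    [(y ^+ 2 - x ^+ 2) * (s + w *+ 2) ^+ 2], so they never have opposite signs. *)
Lemma norm_pairing (X : realDomainType) (x y w : X) : (`|x| <= `|y|)%R ->
  ((`|w| <= `|(y - x) + w|) && (`|x - w| <= `|y + w|) ||
   (`|(y - x) + w| <= `|w|) && (`|y + w| <= `|x - w|))%R.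
Proof.
have sqE (u v : X) : (`|u| <= `|v|)%R = (u ^+ 2 <= v ^+ 2)%R.
  by rewrite -ler_sqr ?nnegrE// !real_normK ?num_real.
rewrite !sqE => xy.
set s := (y - x)%R.
have : (0 <= (w ^+ 2 - (s + w) ^+ 2) * ((x - w) ^+ 2 - (y + w) ^+ 2))%R.
  rewrite (_ : _ * _ = (y ^+ 2 - x ^+ 2) * (s + w *+ 2) ^+ 2)%R; last first.
    by rewrite /s; ring.
  by rewrite mulr_ge0 ?subr_ge0 ?sqr_ge0.
move: (w ^+ 2)%R ((s + w) ^+ 2)%R ((x - w) ^+ 2)%R ((y + w) ^+ 2)%R => A B C D.
have [AB|BA] := ltP B A.
  by rewrite pmulr_rge0 ?subr_gt0// subr_ge0 => ->; rewrite (ltW AB) orbT.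
have [CD|DC] := ltP D C; last by [].
by rewrite pmulr_lge0 ?subr_gt0// subr_ge0 => ->; rewrite (ltW CD) orbT.
Qed.

(* [I] abstracts integration against Lebesgue measure, resp. summation over the
   integers, on a class [M] of nonnegative integrands. *)
Lemma reflected_pairing_le (X : realDomainType) (I : (X -> \bar R) -> \bar R)
    (M : set (X -> \bar R)) (J q : X -> \bar R) :
    (forall F c, M F -> M (fun w => F (c - w)%R)) ->
    (forall F G, M F -> M G -> M (fun w => F w + G w)) ->
    (forall F c, M F -> I (fun w => F (c - w)%R) = I F) ->
    (forall F G, M F -> M G -> I (fun w => F w + G w) = I F + I G) ->
    (forall F G, M F -> M G -> (forall w, F w <= G w) -> I F <= I G) ->
    (forall w, 0 <= J w) -> radially_nondecreasing J ->
    (forall w, 0 <= q w) ->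
    (forall v w, (`|v| <= `|w|)%R -> q w <= q v) ->
    (forall x, M (fun w => J (x + w)%R * q w)) ->
  radially_nondecreasing (fun x => I (fun w => J (x + w)%R * q w)).
Proof.
move=> MN MD IN ID Ile J0 JR q0 qR MJ x y xy.
set F := fun x w : X => J (x + w)%R * q w.
have qE v w : `|v|%R = `|w|%R -> q v = q w.
  by move=> vw; apply/le_anti; rewrite !qR// vw.
pose s := (y - x)%R.
(* [F1] reflects [F x] about 0, while [F2] and [G2] reflect [F1] and [F y] about [- s / 2]. Each
   integral is thus counted twice, and the two sums can be compared pointwise. *)
pose F1 w := F x (0 - w)%R; pose F2 w := F1 (- s - w)%R.
pose G2 w := F y (- s - w)%R.
have MF1 : M F1 by apply/MN/MJ.
have MF2 : M F2 by apply: MN.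
have MG2 : M G2 by apply/MN/MJ.
have IF : I (fun w => F1 w + F2 w) = I (F x) + I (F x).
  have F1E : I F1 = I (F x) by apply: IN; exact: MJ.
  have F2E : I F2 = I F1 by exact: IN.
  by rewrite ID// F2E F1E.
have IG : I (fun w => F y w + G2 w) = I (F y) + I (F y).
  have G2E : I G2 = I (F y) by apply: IN; exact: MJ.
  by rewrite ID ?G2E//; exact: MJ.
have : I (fun w => F1 w + F2 w) <= I (fun w => F y w + G2 w).
  apply: Ile => [||w]; [exact: MD|by apply: MD => //; exact: MJ|].
  have -> : F1 w = J (x - w)%R * q w.
    by rewrite /F1 /F sub0r (qE _ w)// normrN.
  have -> : F2 w = J (y + w)%R * q (s + w)%R.
    rewrite /F2 /F1 /F (qE (0 - _)%R (s + w)%R); last by congr `|_|%R; ring.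
    by congr (J _ * _); rewrite /s; ring.
  have -> : G2 w = J (x - w)%R * q (s + w)%R.
    rewrite /G2 /F (qE (- s - _)%R (s + w)%R); last first.
      by rewrite -opprD normrN.
    by congr (J _ * _); rewrite /s; ring.
  rewrite /F.
  have /orP[/andP[]|/andP[]] := norm_pairing w xy => qw Jw.
    rewrite [leLHS]addeC [leRHS]addeC.
    by apply: ereal_rearrangement => //; [exact: JR|exact: qR].
  by apply: ereal_rearrangement => //; [exact: JR|exact: qR].
(* Halving works for infinite values too: a strict reverse inequality would stay strict after
   doubling. *)
rewrite IF IG; apply: contraTT; rewrite -!ltNge => yx; exact: lteD.
Qed.

End Rearrangement.

(** * Measurability, reflections and densities on the reals *)

Lemma radially_nondecreasing_measurable (R : realType) (f : R -> \bar R) :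
  radially_nondecreasing f -> measurable_fun [set: R] f.
Proof.
move=> fR _; apply: (measurability _ (ErealGenOInfty.measurableE R)) => //.
move=> /= _ [_ [a ->]] <-; rewrite setTI.
rewrite (_ : _ @^-1` _ = ~` [set x | (f x <= a%:E)%E]); last first.
  apply/seteqP; split=> x /=; rewrite in_itv/= andbT leNgt;
    [by move=> ->|by move/negP/negPn].
(* Sublevel sets are intervals, by the quasi-convexity argument. *)
apply: measurableC; apply: is_interval_measurable => x y /= fx fy z /andP[xz zy].
have [z0|z0] := leP 0 z.
- by apply: le_trans fy; apply: fR; rewrite !ger0_norm// (le_trans z0).
- apply: le_trans fx; apply: fR; rewrite !ler0_norm ?lerN2// ?(ltW z0)//.
  by rewrite (le_trans xz)// ltW.
Qed.

Section LebesgueReflection.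
Context (R : realType) (c : R).
Local Notation mu := (@lebesgue_measure R).
Local Open Scope ereal_scope.

Let reflection : measurableTypeR R -> measurableTypeR R := fun w => (c - w)%R.

Let measurable_reflection : measurable_fun setT reflection.
Proof. exact: measurable_funB. Qed.

(** By uniqueness of Lebesgue measure, half-open intervals suffice; reflection swaps the open and
    the closed end and keeps the length. *)
Lemma lebesgue_measure_reflection (A : set R) : measurable A ->
  mu [set w | A (c - w)%R] = mu A.
Proof.
move=> mA; apply/esym.
apply: (@lebesgue_measure_unique _ (pushforward mu reflection)) => //=.
move=> _ [[a b]] _ <-.
rewrite /pushforward.
have -> : reflection @^-1` [set` `]a, b]%R] = [set` `[(c - b)%R, (c - a)%R[%R].
  by apply/seteqP; split=> w /=; rewrite /reflection !in_itv/=
    => /andP[? ?]; apply/andP; split; lra.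
rewrite !lebesgue_measure_itv/= !lte_fin ltrD2l ltrN2 -!EFinB.
by case: ifP => // _; congr EFin; ring.
Qed.

Lemma ge0_integral_reflection (f : R -> \bar R) : measurable_fun setT f ->
  (forall w, 0 <= f w) -> \int[mu]_w f (c - w)%R = \int[mu]_w f w.
Proof.
move=> mf f0.
rewrite -(@ge0_integral_pushforward _ _ _ _ _ _ measurable_reflection mu
  setT f)//.
apply: eq_measure_integral => //= A mA _.
exact: lebesgue_measure_reflection.
Qed.

End LebesgueReflection.

Section Density.
Context d (T : measurableType d) (R : realType).
Context (mu nu : {measure set T -> \bar R}) (g : T -> \bar R).
Local Open Scope ereal_scope.
Hypotheses (mg : measurable_fun setT g) (g0 : forall x, 0 <= g x).
Hypothesis g_fin : forall x, g x \is a fin_num.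
Hypothesis nuE : forall A, measurable A -> nu A = \int[mu]_(x in A) g x.

Import HBNNSimple.

Let nnsfun_case (h : {nnsfun T >-> R}) :
  \int[nu]_x (h x)%:E = \int[mu]_x ((h x)%:E * g x).
Proof.
have hE x : (h x)%:E = \sum_(r \in range h) (r * \1_(h @^-1` [set r]) x)%:E.
  by rewrite fsumEFin// -fimfunE.
have hgE x : (h x)%:E * g x =
    \sum_(r \in range h) ((r * \1_(h @^-1` [set r]) x)%:E * g x).
  by rewrite -ge0_mule_fsuml ?hE// => r; exact: nnfun_muleindic_ge0.
have mh r : measurable_fun setT (fun x => (r * \1_(h @^-1` [set r]) x)%:E).
  by apply/measurable_EFinP; exact: measurable_funM.
under eq_integral do rewrite hE.
rewrite ge0_integral_fsum//; last by move=> r x _; exact: nnfun_muleindic_ge0.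
under [RHS]eq_integral do rewrite hgE.
rewrite ge0_integral_fsum//; last 2 first.
- by move=> r; exact: emeasurable_funM.
- by move=> r x _; rewrite mule_ge0// nnfun_muleindic_ge0.
apply: eq_fsbigr => r _.
rewrite integralZl_indic_nnsfun// integral_indic// setIT nuE//.
(* Membership of [r] in the range of [h] has been dropped, so a negative [r] has to be treated; its
   level set is empty. *)
have [r0|r0] := ltP r 0%R.
  rewrite preimage_nnfun0// integral_set0 mule0 integral0_eq// => x _.
  by rewrite indicE in_set0 mulr0 mul0e.
under [RHS]eq_integral do rewrite EFinM -muleA.
rewrite ge0_integralZl//; last 2 first.
- apply: emeasurable_funM => //; exact/measurable_EFinP.
- by move=> x _; rewrite mule_ge0// lee_fin.
congr (_ * _); rewrite integral_mkcond; apply: eq_integral => x _.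
by rewrite epatch_indic /= muleC.
Qed.

(** Monotone convergence on both sides extends the identity from simple functions; finiteness of
    [g x] lets multiplication by it pass to the limit. *)
Lemma ge0_integral_density (f : T -> \bar R) : measurable_fun setT f ->
  (forall x, 0 <= f x) -> \int[nu]_x f x = \int[mu]_x (f x * g x).
Proof.
move=> mf f0; pose h := nnsfun_approx measurableT mf.
have hf x : EFin (h n x) @[n --> \oo] --> f x by exact: cvg_nnsfun_approx.
have ndh x m n : (m <= n)%N -> (h m x <= h n x)%R.
  by move=> mn; exact/lefP/nd_nnsfun_approx.
transitivity (limn (fun n => \int[nu]_x (h n x)%:E)).
  rewrite -monotone_convergence//.
  - by apply: eq_integral => x _; apply/esym/cvg_lim.
  - by move=> n; exact/measurable_EFinP/measurable_funP.
  - by move=> n x _; rewrite lee_fin.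
  - by move=> x _ m n mn; rewrite lee_fin ndh.
under eq_fun do rewrite nnsfun_case.
rewrite -monotone_convergence//.
- apply: eq_integral => x _; apply/cvg_lim => //.
  by apply: cvgeZr.
- move=> n; apply: emeasurable_funM => //.
  exact/measurable_EFinP/measurable_funP.
- by move=> n x _; rewrite mule_ge0// lee_fin.
- by move=> x _ m n mn; rewrite lee_wpmul2r// lee_fin ndh.
Qed.

End Density.

(** * Integer noise: expectations as sums *)

Section IntegerNoise.
Context d (T : measurableType d) (R : realType) (mu : {measure set T -> \bar R}).
Context (W : T -> int).
Hypothesis mW : forall n, measurable (W @^-1` [set n]).
Local Open Scope ereal_scope.

Lemma integer_noise_measurable (Y : set int) : measurable (W @^-1` Y).
Proof.
rewrite (_ : W @^-1` Y = \bigcup_n (W @^-1` [set m | m = n /\ Y n])); last first.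
  by apply/seteqP; split=> [w Yw|w [n _ [/= -> //]]]; exists (W w).
apply: countable_bigcupT_measurable => // n.
have [Yn|Yn] := pselect (Y n).
  rewrite (_ : [set m | _] = [set n]); first exact: mW.
  by apply/seteqP; split=> m /= => [[]|].
by rewrite (_ : _ @^-1` _ = set0)//; apply/seteqP; split=> w // -[].
Qed.

(** The integers are enumerated by a bijection [e] from the naturals, so that the integral splits
    over the countably many fibres of [W], on each of which the integrand is constant. *)
Lemma ge0_integral_integer_noise (f : int -> \bar R) : (forall n, 0 <= f n) ->
  \int[mu]_w f (W w) = \esum_(n in [set: int]) (f n * mu (W @^-1` [set n])).
Proof.
move=> f0.
have int_infinite : infinite_set [set: int].
  apply: (@sub_infinite_set _ (range Posz)) => //.
  have Posz_inj : set_inj [set: nat] Posz by move=> m n _ _ [].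
  by rewrite (eq_finite_set (inj_card_eq Posz_inj)); exact: infinite_nat.
have /card_set_bijP[e e_bij] := eq_card_nat (countableP [set: int]) int_infinite.
have e_inj : injective e by move=> m n; apply: (set_bij_inj e_bij); rewrite inE.
pose F k := W @^-1` (e @^-1` [set k]).
have FE n : F (e n) = W @^-1` [set n].
  by rewrite /F; congr (_ @^-1` _);
    apply/seteqP; split=> m /=;
    [apply: e_inj|move=> ->].
have -> : \int[mu]_w f (W w) = \int[mu]_(w in \bigcup_k F k) f (W w).
  by congr integral; apply/seteqP; split=> // w _; exists (e (W w)).
rewrite ge0_integral_bigcup//; last 3 first.
- by move=> k; exact: integer_noise_measurable.
- move=> _ Y _; apply: measurableI.
    by apply: bigcupT_measurable => k; exact: integer_noise_measurable.
  exact: (integer_noise_measurable (f @^-1` Y)).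
- by move=> i j _ _ [w [/= <- <-]].
rewrite nneseries_esumT; last by move=> n; exact: integral_ge0.
rewrite (reindex_esum _ _ _ _ e_bij); apply: eq_esum => n _.
rewrite FE -(integral_cst mu (mW n)).
by apply: eq_integral => w; rewrite inE /= => ->.
Qed.

End IntegerNoise.

(** * Expectations and the Bellman recursion *)

Lemma expectation_radially_nondecreasing (R : realType) (k : source_kind)
    (disp : measure_display) (Omega : measurableType disp)
    (P : probability Omega R) (W : Omega -> alphabet R k)
    (J : alphabet R k -> \bar R) :
    symmetric_unimodal_noise P W -> (forall x, (0 <= J x)%E) ->
    radially_nondecreasing J ->
  radially_nondecreasing (fun x => (\int[P]_w J (x + W w)%R)%E).
Proof.
(* Both cases write the expectation as a functional of [J (x + w) * q w]: a sum with [q] the pmf, or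
   a Lebesgue integral with [q] the pdf. *)
case: k W J => /= W J.
- move=> [mW q_even q_uni] J0 JR x y xy.
  have EE z : (\int[P]_w J (z + W w)%R =
      \esum_(n in [set: int]) (J (z + n)%R * P (W @^-1` [set n])))%E.
    by rewrite -(ge0_integral_integer_noise P mW).
  rewrite !EE.
  apply: (@reflected_pairing_le _ _ (fun F => \esum_(n in [set: int]) F n)%E
      [set F | forall n, (0 <= F n)%E] J (fun n => P (W @^-1` [set n]))) => //=.
  + by move=> F G F0 G0 n; rewrite adde_ge0.
  + move=> F c F0; rewrite [RHS](reindex_esum setT setT (fun n => c - n))//.
    by split=> // [m n _ _ /addrI/oppr_inj//|n _]; exists (c - n) => //; ring.
  + by move=> F G F0 G0; rewrite esumD.
  + by move=> F G F0 G0 FG; apply: le_esum.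
  + exact: even_unimodal_norm.
  + by move=> z n; rewrite mule_ge0.
- move=> [mW [q [mq q0 WE q_even q_uni]]] J0 JR x y xy.
  have mJ := radially_nondecreasing_measurable JR.
  have mJD z : measurable_fun setT (fun w : R => J (z + w)).
    by apply: (measurableT_comp mJ); exact: measurable_funD.
  have mEq : measurable_fun setT (EFin \o q) by exact/measurable_EFinP.
  pose V : Omega -> measurableTypeR R := W.
  have mV : measurable_fun setT V by exact: mW.
  have EE z : (\int[P]_w J (z + W w)%R =
      \int[lebesgue_measure]_w (J (z + w)%R * (q w)%:E))%E.
    transitivity (\int[pushforward P V]_w J (z + w)%R)%E.
      by rewrite (ge0_integral_pushforward mV)//; exact: mJD.
    apply: (@ge0_integral_density _ _ _ lebesgue_measure (pushforward P V) _ mEq)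
      => //; exact: mJD.
  rewrite !EE.
  apply: (@reflected_pairing_le _ _ (fun F => \int[lebesgue_measure]_w F w)%E
      [set F | measurable_fun setT F /\ forall w, (0 <= F w)%E]
      J (EFin \o q)) => //=.
  + move=> F c [mF F0]; split=> //.
    by apply: (measurableT_comp mF); exact: measurable_funB.
  + move=> F G [mF F0] [mG G0]; split; first exact: emeasurable_funD.
    by move=> w; rewrite adde_ge0.
  + by move=> F c [mF F0]; exact: ge0_integral_reflection.
  + by move=> F G [mF F0] [mG G0]; rewrite ge0_integralD.
  + by move=> F G [mF F0] [mG G0] FG; apply: ge0_le_integral.
  + by move=> v w vw; rewrite lee_fin; exact: (even_unimodal_norm q_even q_uni).
  + move=> z; split; first exact: emeasurable_funM.
    by move=> w; rewrite mule_ge0// lee_fin.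
Qed.

Theorem corollary4 (R : realType) (k : source_kind)
    (disp : measure_display) (Omega : measurableType disp)
    (P : probability Omega R)
    (a : alphabet R k) (W : Omega -> alphabet R k)
    (hW : symmetric_unimodal_noise P W)
    (U : set R) (umax : R) (humax : 0 <= umax) (hU : action_set U umax)
    (p : R -> R)
    (p_range : forall u, U u -> 0 <= p u <= 1)
    (p_decr : forall u v, U u -> U v -> u <= v -> p v <= p u)
    (p0 : p 0 = 1)
    (lam : R -> R)
    (lam_incr : forall u v, U u -> U v -> u <= v -> lam u <= lam v)
    (lam0 : lam 0 = 0)
    (d : alphabet R k -> R)
    (d_even : even_function d) (d_qc : quasi_convex d) (d0 : d 0 = 0)
    (T : nat) (J : nat -> alphabet R k -> \bar R)
    (hJ : value_functions P a W lam p d U T J) :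
  forall t, (t <= T)%N ->
    [/\ even_function (J t), quasi_convex (J t) &
        exists f : alphabet R k -> R,
          [/\ (forall e,
                 is_argmin U (stage_cost P a W lam p d (J t.+1) e) (f e)),
              even_function f & quasi_convex f]].
Proof.
have [U0 Umax U_ge0 U_le] : [/\ U 0, U umax, (forall u, U u -> 0 <= u) &
    (forall u, U u -> u <= umax)].
  have [[_ U0 Umax Usub]|->] := hU.
    by split=> // u /Usub; rewrite /= in_itv/= => /andP[].
  by split=> [||u|u]; rewrite /= in_itv/= ?lexx ?humax// => /andP[].
have dR : radially_nondecreasing d by apply/even_quasi_convexP.
have d_ge0 e : 0 <= d e by rewrite -d0; apply: dR; rewrite normr0.
have lam_ge0 u : U u -> 0 <= lam u.
  by move=> Uu; rewrite -lam0; apply: lam_incr => //; exact: U_ge0.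
have [J_end J_step] := hJ.
pose h t (e : alphabet R k) : \bar R := (\int[P]_w J t (a * e + W w)%R)%E.
pose K t : \bar R := (\int[P]_w J t (W w))%E.
pose g t e : \bar R := ((d e)%:E + h t e)%E.
have step t : (t <= T)%N -> (forall e, (0 <= J t.+1 e)%E) ->
    radially_nondecreasing (J t.+1) ->
    [/\ (0 <= K t.+1)%E, (forall e, (K t.+1 <= g t.+1 e)%E),
        radially_nondecreasing (g t.+1) &
        forall e, stage_cost P a W lam p d (J t.+1) e =
                  switching_cost lam p (K t.+1) (g t.+1 e)].
  move=> tT J0 JR.
  have ER := expectation_radially_nondecreasing hW J0 JR.
  have h0 e : (0 <= h t.+1 e)%E by exact: integral_ge0.
  split=> [|e|e e' ee'|e]; first exact: integral_ge0.
  (* [K t.+1] is the expectation at displacement 0, hence the least one, and [d e >= 0]. *)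
  - apply: (@le_trans _ _ (h t.+1 e)); last by rewrite leeDr ?lee_fin.
    have := ER 0 (a * e); rewrite normr0 normr_ge0 => /(_ isT).
    by under eq_integral do rewrite add0r.
  - apply: leeD; first by rewrite lee_fin dR.
    by apply: ER; rewrite !normrM ler_wpM2l.
  - apply/funext => u; rewrite /stage_cost /switching_cost /g.
    by rewrite [(_ * (_ + h _ _))%E]ge0_muleDr ?lee_fin// addeA.
have [J0 JR] : (forall t, (t <= T.+1)%N -> forall e, (0 <= J t e)%E) /\
    (forall t, (t <= T.+1)%N -> radially_nondecreasing (J t)).
  (* Backward induction: [n] counts the steps back from the terminal time [T.+1]. *)
  suff JP n : (n <= T.+1)%N -> (forall e, (0 <= J (T.+1 - n)%N e)%E) /\
      radially_nondecreasing (J (T.+1 - n)%N).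
    by split=> t tT; have := JP _ (leq_subr t T.+1); rewrite subKn// => -[].
  elim: n => [_|n IH nT].
    by rewrite subn0; split=> [e|e e' _]; rewrite !J_end.
  have [] := IH (ltnW nT); rewrite subSS subSn//.
  set t := (T - n)%N => J0 JR; have tT : (t <= T)%N by exact: leq_subr.
  have [K0 Kg gR cE] := step _ tT J0 JR; split=> [e|e e' ee'].
    have [u [Uu _] ->] := J_step t e tT; rewrite cE /switching_cost.
    have /andP[pu0 pu1] := p_range u Uu.
    by rewrite !adde_ge0 ?mule_ge0 ?lee_fin ?subr_ge0 ?lam_ge0// (le_trans K0).
  (* The minimiser [v] at [e'] is tried at [e], where it costs no more than at [e']. *)
  have [u [Uu uP] ->] := J_step t e tT; have [v [Uv _] ->] := J_step t e' tT.
  apply: (@le_trans _ _ (stage_cost P a W lam p d (J t.+1) e v)).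
    by apply: uP; exists v.
  have /andP[pv0 pv1] := p_range v Uv.
  by rewrite !cE /switching_cost leeD2r// leeD2l// lee_wpmul2l ?lee_fin// gR.
move=> t tT; have [K0 Kg gR cE] := step t tT (J0 t.+1 tT) (JR t.+1 tT).
have /even_quasi_convexP[Je Jq] := JR t (leqW tT).
have gA e : exists u, is_argmin U (switching_cost lam p (K t.+1) (g t.+1 e)) u.
  by rewrite -cE; have [u] := J_step t e tT; exists u.
have [f [fP /even_quasi_convexP[fe fq]]] := monotone_argmin_selection Umax U_le
  p_range p_decr lam_incr K0 Kg gR gA.
by split=> //; exists f; split=> // e; rewrite cE.
Qed.
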